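(* Let $X$ be an at most countable set and let $(X,P)$ be an irreducible, time-homogeneous Markov chain on $X$ with stochastic transition matrix $P=(p(x,y))_{x,y\in X}$. Suppose that there exist $\epsilon\in(0,1)$ and a finite subset $A\subset X$ such that $$\sup_{x\in X}\ \sum_{y\in X\setminus A} p(x,y)<\epsilon .$$ Then $(X,P)$ is positive recurrent.
   Context: A Markov chain (random walk) $(X,P)$ is given by an at most countable state space $X$ and a stochastic matrix $P=(p(x,y))_{x,y\in X}$ (i.e. $p(x,y)\ge 0$ and $\sum_{y\in X}p(x,y)=1$ for all $x\in X$) describing a chain $\{Z_n\}_{n\in\mathbb{N}}$ on a probability space $(\Omega,\mathcal{F},\mathbb{P})$ with $p(x,y)=\mathbb{P}[Z_{n+1}=y\mid Z_n=x]$ for all $n$. Write $p^{(n)}(x,y)$ for the entries of the $n$-th power of $P$. The chain is irreducible if for all $x,y\in X$ there is $n\in\mathbb{N}$ with $p^{(n)}(x,y)>0$. First return probabilities: $f^{(0)}(x,y)=0$ and, for $n\ge 1$, $f^{(n)}(x,y)=\mathbb{P}(Z_n=y,\ Z_i\ne y \text{ for all } i=1,\dots,n-1\mid Z_0=x)$. Put $F(x,y)=\sum_{n=0}^\infty f^{(n)}(x,y)$. An irreducible chain is transient if $F(x,x)<1$ for some (equivalently, for every) $x\in X$, and recurrent otherwise. A recurrent irreducible chain is positive recurrent if $\overline{\tau}_x:=\sum_{n=1}^\infty n f^{(n)}(x,x)<+\infty$ for some (equivalently, for every) $x\in X$, and null recurrent otherwise. *)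

(* Defs.v *)
From HB Require Import structures.
From mathcomp Require Import all_boot all_order all_algebra.
From mathcomp Require Import all_classical all_reals all_analysis.

Set Implicit Arguments.
Unset Strict Implicit.
Unset Printing Implicit Defensive.

Import Order.TTheory GRing.Theory Num.Theory.
Import numFieldNormedType.Exports.
Local Open Scope classical_set_scope.
Local Open Scope ring_scope.

Section transition_matrix.
Context (R : realType) (X : countType).
Implicit Types p : X -> X -> R.

Definition stochastic p : Prop :=
  (forall x y, 0 <= p x y) /\
  (forall x, \esum_(y in [set: X]) (p x y)%:E = 1%E).

(* Entries of powers are kept in \bar R, so that the possibly infinite sums
   over X need no summability side conditions. *)
Fixpoint mpow p (n : nat) (x y : X) : \bar R :=
  if n is n'.+1 then \esum_(z in [set: X]) ((p x z)%:E * mpow p n' z y)%E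
  else ((x == y)%:R)%:E.

Definition irreducible p : Prop :=
  forall x y, exists n, (0 < mpow p n x y)%E.

End transition_matrix.

Section markov_chain.
Context (R : realType) (X : countType).
Context (d : measure_display) (Omega : measurableType d).
Implicit Types (p : X -> X -> R) (Z : nat -> Omega -> X).

(* P[E | F], meaningful only when P F > 0. *)
Definition cond_prob (P : probability Omega R) (E F : set Omega) : R :=
  fine (P (E `&` F)) / fine (P F).

(* Z is a time-homogeneous Markov chain under P with transition matrix p:
   each Z n is a random variable (X carries the discrete sigma-algebra), the
   past influences the next step only through the current state, and one-step
   conditional probabilities are the entries of p. *)
Definition markov_chain (P : probability Omega R) Z p : Prop :=
  [/\ forall n (B : set X), measurable (Z n @^-1` B),
      forall n (c : nat -> X) (y : X),
        let history := [set w | forall i, (i <= n)%N -> Z i w = c i] in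
        (0 < P history)%E ->
        cond_prob P [set w | Z n.+1 w = y] history =
        cond_prob P [set w | Z n.+1 w = y] [set w | Z n w = c n]
    & forall n (x y : X),
        (0 < P [set w | Z n w = x])%E ->
        cond_prob P [set w | Z n.+1 w = y] [set w | Z n w = x] = p x y].

(* P[ . | Z_0 = x] has to make sense for every x, whatever the initial law;
   as usual it is the law P x under which the chain starts at x. *)
Definition markov_family (P : X -> probability Omega R) Z p : Prop :=
  forall x, P x [set w | Z 0%N w = x] = 1%E /\ markov_chain (P x) Z p.

Section first_return.
Context (P : X -> probability Omega R) (Z : nat -> Omega -> X).

Definition first_return (n : nat) (x y : X) : \bar R :=
  if n is 0%N then 0%E
  else P x [set w | Z n w = y /\
                    forall i, (1 <= i < n)%N -> Z i w <> y].

Definition return_prob (x y : X) : \bar R :=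
  (\sum_(0 <= n <oo) first_return n x y)%E.

Definition mean_return_time (x : X) : \bar R :=
  (\sum_(1 <= n <oo) (n%:R%:E * first_return n x x))%E.

Definition transient : Prop := exists x, (return_prob x x < 1)%E.

Definition recurrent : Prop := ~ transient.

(* For irreducible chains "for some x" and "for every x" are equivalent here. *)
Definition positive_recurrent : Prop :=
  recurrent /\ forall x, (mean_return_time x < +oo)%E.

End first_return.
End markov_chain.

(* Main.v *)
(* Some power of P leads from every point of the finite set A to the state x0
   with positive probability, and A is entered in one step with probability at
   least 1 - eps from anywhere. So there are c > 0 and M such that, uniformly in
   the starting point, x0 is visited within M steps with probability at least c.
   Hence the probability q_n of no return to x0 up to time n decays
   geometrically along multiples of M, and q_n has a finite sum; this bounds
   the mean return time, and forces q_n -> 0, that is F(x0, x0) = 1. *)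
Require Import Defs.
From mathcomp Require Import all_boot all_order all_algebra.
From mathcomp Require Import all_classical all_reals all_analysis.
From mathcomp Require Import ring lra.
Import Order.TTheory GRing.Theory Num.Theory.
Local Open Scope classical_set_scope.
Local Open Scope ring_scope.

(** * Sums over a countable type as series *)

Section countable_sums.
Context {R : realType} {X : countType}.
Local Open Scope ereal_scope.

(** This gives access to scaling and countable additivity of series. Since [pickle] is injective,
    each point occupies one index; an index that codes no point carries the default term 0. *)
Lemma esum_pickle (a : X -> \bar R) : (forall x, 0 <= a x) ->
  \esum_(x in [set: X]) a x = \sum_(n <oo) oapp a 0 (pickle_inv n).
Proof.
move=> a0; have g0 n : 0 <= oapp a 0 (@pickle_inv X n) by case: pickle_inv.
rewrite nneseries_esumT// (esumID (range (@pickle X)))// !setTI.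
rewrite [X in _ + X]esum1 ?adde0; last first.
  move=> n /= nP; case E : (pickle_inv n) => [x|//]; case: nP; exists x => //.
  by have := @pickle_invK X n; rewrite E.
rewrite esum_image; last by move=> x y _ _; exact: (pcan_inj pickleK_inv).
by apply: eq_esum => x _; rewrite pickleK_inv.
Qed.

Lemma esumZl (c : R) (a : X -> \bar R) : (forall x, 0 <= a x) -> (0 <= c)%R ->
  \esum_(x in [set: X]) (c%:E * a x) = c%:E * \esum_(x in [set: X]) a x.
Proof.
move=> a0 c0; have ca0 x : 0 <= c%:E * a x by rewrite mule_ge0// lee_fin.
rewrite !esum_pickle//.
rewrite -nneseriesZl; last by move=> n _; case: pickle_inv.
by apply: eq_eseriesr => n _; case: pickle_inv => //=; rewrite mule0.
Qed.

Lemma measure_esum_fibers {d} {Omega : measurableType d}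
    (P : {measure set Omega -> \bar R}) (f : Omega -> X) (E : set Omega) :
  measurable E -> (forall B : set X, measurable (f @^-1` B)) ->
  P E = \esum_(x in [set: X]) P (E `&` f @^-1` [set x]).
Proof.
move=> mE mf; rewrite esum_pickle//.
pose F n := oapp (fun x => E `&` f @^-1` [set x]) set0 (@pickle_inv X n).
have mF n : measurable (F n).
  by rewrite /F; case: pickle_inv => //= x; exact: measurableI.
have EF : E = \bigcup_n F n.
  apply/seteqP; split => [w Ew|w [n _]].
    by exists (pickle (f w)); rewrite // /F pickleK_inv.
  by rewrite /F; case: pickle_inv => //= x [].
rewrite [in LHS]EF measure_semi_bigcup//.
- by apply: eq_eseriesr => n _; rewrite /F; case: pickle_inv => //=.
- apply/trivIsetP => i j _ _ ij; apply/seteqP; split=> // w [].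
  rewrite /F; have := @pickle_invK X i; have := @pickle_invK X j.
  case: pickle_inv => //= y yj; case: pickle_inv => //= x xi [_ wx] [_ wy].
  by move: ij; rewrite -xi -yj -wx -wy eqxx.
- by rewrite -EF.
Qed.

End countable_sums.

(** * Avoidance probabilities computed from the matrix *)

Section taboo.
Context {R : realType} {X : countType} (p : X -> X -> R) (hp : stochastic p).
Variable x0 : X.
Local Open Scope ereal_scope.

Definition kill (f : X -> \bar R) (y : X) : \bar R := if y == x0 then 0 else f y.

(** The transition operator with the column of [x0] set to zero, that is, of the chain killed on
    entering [x0]. *)
Definition taboo_step (f : X -> \bar R) (x : X) : \bar R :=
  \esum_(y in [set: X]) ((p x y)%:E * kill f y).

(* The probability that the chain started at x avoids x0 at times 1, ..., n. *)
Definition avoid_prob (n : nat) : X -> \bar R := iter n taboo_step (cst 1).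

Let p0 x y : 0 <= (p x y)%:E.
Proof. by rewrite lee_fin; case: hp. Qed.

Lemma kill_ge0 f y : (forall x, 0 <= f x) -> 0 <= kill f y.
Proof. by move=> f0; rewrite /kill; case: ifP. Qed.

Lemma taboo_step_ge0 f x : (forall x, 0 <= f x) -> 0 <= taboo_step f x.
Proof.
by move=> f0; apply: esum_ge0 => y _; apply: mule_ge0 => //; exact: kill_ge0.
Qed.

Lemma le_taboo_step f g x : (forall x, 0 <= f x) ->
  (forall x, f x <= g x) -> taboo_step f x <= taboo_step g x.
Proof.
move=> f0 fg; apply: le_esum => y _; apply: lee_wpmul2l => //.
by rewrite /kill; case: ifP.
Qed.

Lemma taboo_stepZ (c : R) f x : (0 <= c)%R -> (forall x, 0 <= f x) ->
  taboo_step (fun y => c%:E * f y) x = c%:E * taboo_step f x.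
Proof.
move=> c0 f0; rewrite /taboo_step -esumZl//; last first.
  by move=> y; apply: mule_ge0 => //; exact: kill_ge0.
apply: eq_esum => y _; rewrite /kill; case: ifP => _; rewrite ?mule0//.
by rewrite muleCA.
Qed.

Lemma esum_stochastic_le1 (g : X -> \bar R) x :
  (forall y, 0 <= g y <= 1) ->
  \esum_(y in [set: X]) ((p x y)%:E * g y) <= 1.
Proof.
move=> g01; case: hp => _ /(_ x) <-; apply: le_esum => y _.
by rewrite -[leRHS]mule1; apply: lee_wpmul2l => //; case/andP: (g01 y).
Qed.

Lemma avoid_prob_ge0 n x : 0 <= avoid_prob n x.
Proof. by elim: n x => // n IH x; exact: taboo_step_ge0. Qed.

Lemma avoid_prob_le1 n x : avoid_prob n x <= 1.
Proof.
elim: n x => // n IH x; apply: esum_stochastic_le1 => y.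
apply/andP; split; first by apply: kill_ge0 => ?; exact: avoid_prob_ge0.
by rewrite /kill; case: ifP.
Qed.

Lemma mpow_ge0 n x y : 0 <= mpow p n x y.
Proof.
elim: n x => [|n IH] x /=; first by rewrite lee_fin ler0n.
by apply: esum_ge0 => z _; exact: mule_ge0.
Qed.

Lemma mpow_le1 n x y : mpow p n x y <= 1.
Proof.
elim: n x => [|n IH] x /=; first by rewrite lee_fin lern1 leq_b1.
by apply: esum_stochastic_le1 => z; rewrite mpow_ge0 IH.
Qed.

(* Avoiding x0 up to time n and being at x0 at time k <= n are disjoint. *)
Lemma kill_avoid_mpow_le1 k n x : (k <= n)%N ->
  kill (avoid_prob n) x + mpow p k x x0 <= 1.
Proof.
rewrite /kill; elim: n k x => [|n IH] k x kn; case: eqP => [_|/eqP xx0];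
  rewrite ?add0e ?mpow_le1//; case: k kn => [|k] kn //.
- by rewrite /= (negbTE xx0) adde0.
- by rewrite /= (negbTE xx0) adde0; exact: (avoid_prob_le1 n.+1).
(* Both terms are averages over the first step [z], so they merge into one sum whose integrand is
   bounded by the induction hypothesis. *)
- rewrite -[avoid_prob _ _]/(taboo_step _ _) /taboo_step -esumD; last 2 first.
    by move=> z _; rewrite mule_ge0// kill_ge0// => ?; exact: avoid_prob_ge0.
    by move=> z _; rewrite mule_ge0// mpow_ge0.
  under eq_esum => z _.
    rewrite -ge0_muleDr; last 2 first.
      by apply: kill_ge0 => ?; exact: avoid_prob_ge0.
      exact: mpow_ge0.
    over.
  apply: esum_stochastic_le1 => z; rewrite (IH k)// andbT adde_ge0 ?mpow_ge0//.
  by apply: kill_ge0 => ?; exact: avoid_prob_ge0.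
Qed.

(** Induction on a list enumerating [A]: each new point replaces [c] by a minimum and [M] by a
    maximum. The exponent [k] still depends on the point. *)
Lemma irreducible_mpow_bound (A : set X) : irreducible p -> finite_set A ->
  exists (c : R) M, (0 < c <= 1)%R /\
    forall a, A a -> exists2 k, (k <= M)%N & c%:E <= mpow p k a x0.
Proof.
move=> hirr /finite_seqP[s ->]; elim: s => [|a s [c [M [/andP[c0 c1] hc]]]].
  by exists 1%R, 0%N; rewrite ltr01 lexx.
have [k k0] := hirr a x0.
have kfin : mpow p k a x0 \is a fin_num.
  by rewrite ge0_fin_numE ?mpow_ge0//; apply: le_lt_trans (mpow_le1 _ _ _) (ltry _).
exists (Num.min c (fine (mpow p k a x0))), (maxn M k); split.
  by rewrite lt_min c0 ge_min c1 fine_gt0// k0 ltey_eq kfin.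
move=> b /=; rewrite inE => /orP[/eqP ->|/hc[j jM hj]].
  by exists k; rewrite ?leq_maxr// -[leRHS]fineK// lee_fin ge_min lexx orbT.
exists j; first by rewrite leq_max jM.
by apply: le_trans hj; rewrite lee_fin ge_min lexx.
Qed.

(** One step enters [A] with probability at least [1 - eps], and from [A] the state [x0] is met
    within [M] further steps with probability at least [c]. The new constants are therefore
    [c * (1 - eps)] and [M.+1]. *)
Lemma avoid_prob_uniform (eps : R) (A : set X) : irreducible p ->
  (eps < 1)%R -> finite_set A ->
  (forall x, \esum_(y in ~` A) (p x y)%:E <= eps%:E) ->
  exists (c : R) M, (0 < c <= 1)%R /\
    forall x, avoid_prob M x <= (1 - c)%:E.
Proof.
move=> hirr eps1 Afin hA.
have [c [M [/andP[c0 c1] hc]]] := irreducible_mpow_bound A hirr Afin.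
have pA x : \esum_(y in A) (p x y)%:E + \esum_(y in ~` A) (p x y)%:E = 1.
  by case: hp => _ /(_ x) <-; rewrite [RHS](esumID A)// !setTI.
have eps0 : (0 <= eps)%R.
  by rewrite -lee_fin; apply: le_trans (hA x0); exact: esum_ge0.
exists (c * (1 - eps))%R, M.+1; split => //.
  by rewrite mulr_gt0 ?subr_gt0//= mulr_ile1 ?(ltW c0)//; lra.
move=> x; rewrite -[avoid_prob _ _]/(taboo_step _ _).
(* After the first step to [y], it suffices that [kill (avoid_prob M) y], increased by [c] when [y]
   lies in [A], is at most 1. On [A] this is [kill_avoid_mpow_le1]. *)
have bound : taboo_step (avoid_prob M) x + c%:E * (\esum_(y in A) (p x y)%:E) <= 1.
  rewrite [in X in _ + X]esum_mkcond -esumZl; last 2 first.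
  - by move=> y; case: ifP.
  - exact: ltW.
  rewrite /taboo_step -esumD; last 2 first.
  - by move=> z _; rewrite mule_ge0// kill_ge0// => ?; exact: avoid_prob_ge0.
  - by move=> z _; rewrite mule_ge0// ?lee_fin ?(ltW c0)//; case: ifP => // _.
  have -> : \esum_(y in [set: X]) ((p x y)%:E * kill (avoid_prob M) y +
        c%:E * (if y \in A then (p x y)%:E else 0)) =
      \esum_(y in [set: X]) ((p x y)%:E * (kill (avoid_prob M) y +
        c%:E * (if y \in A then 1 else 0))).
    apply: eq_esum => y _; rewrite ge0_muleDr.
    - by case: ifP => _; rewrite ?mule0// mule1 [c%:E * _]muleC.
    - by apply: kill_ge0 => ?; exact: avoid_prob_ge0.
    - by rewrite mule_ge0// ?lee_fin ?(ltW c0)//; case: ifP.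
  apply: esum_stochastic_le1 => y.
  have k0 : 0 <= kill (avoid_prob M) y.
    by apply: kill_ge0 => ?; exact: avoid_prob_ge0.
  apply/andP; split.
    by rewrite adde_ge0// mule_ge0// ?lee_fin ?(ltW c0)//; case: ifP.
  case: ifPn => [|_]; last first.
    rewrite mule0 adde0 /kill; case: ifP => // _; exact: avoid_prob_le1.
  rewrite inE mule1 => /hc[k kM ck].
  by apply: le_trans (kill_avoid_mpow_le1 k M y kM); exact: leeD2l.
have tfin : taboo_step (avoid_prob M) x \is a fin_num.
  rewrite ge0_fin_numE ?(avoid_prob_ge0 M.+1)//.
  by apply: le_lt_trans (avoid_prob_le1 M.+1 x) (ltry _).
have A0 : 0 <= \esum_(y in A) (p x y)%:E by exact: esum_ge0.
have B0 : 0 <= \esum_(y in ~` A) (p x y)%:E by exact: esum_ge0.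
(* In the reals: [t + c * a <= 1], [a + b = 1] and [b <= eps] give [t <= 1 - c * (1 - eps)]. *)
move: bound (pA x) (hA x) A0 B0.
move: tfin; case: taboo_step => // t _.
case: (\esum_(y in A) _) => [a| |] //; case: (\esum_(y in ~` A) _) => [b| |] //.
rewrite -EFinM -!EFinD !lee_fin => h1 [h2] h3 h4 h5; nra.
Qed.

(** The case [n = 0] is the uniform bound; each further [taboo_step] preserves the inequality, being
    monotone and homogeneous. *)
Lemma avoid_prob_geometric (c : R) M : (c <= 1)%R ->
  (forall x, avoid_prob M x <= (1 - c)%:E) ->
  forall n x, avoid_prob (n + M) x <= (1 - c)%:E * avoid_prob n x.
Proof.
move=> c1 hM; elim=> [|n IH] x; first by rewrite mule1.
rewrite addSn [leLHS]/= [avoid_prob n.+1 x]/= -taboo_stepZ; last 2 first.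
- by rewrite subr_ge0.
- exact: avoid_prob_ge0.
by apply: le_taboo_step => // y; exact: avoid_prob_ge0.
Qed.

End taboo.

(** * Events on trajectories and their measurability *)

Section path_events.
Context {X : countType} {d : measure_display} {Omega : measurableType d}.
Context (Z : nat -> Omega -> X).
Hypothesis mZ : forall n (B : set X), measurable (Z n @^-1` B).
Variable x0 : X.

Definition cylinder (n : nat) (c : nat -> X) : set Omega :=
  [set w | forall i, (i <= n)%N -> Z i w = c i].

(** Time [n] itself is left out, so that a start at [x0] does not count as a return. *)
Definition avoids (n k : nat) : set Omega :=
  [set w | forall i, (n < i <= n + k)%N -> Z i w <> x0].

Lemma measurable_cylinder n c : measurable (cylinder n c).
Proof.
have -> : cylinder n c =
    \bigcap_(i in [set i | (i <= n)%N]) (Z i @^-1` [set c i]) by [].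
by apply: bigcap_measurableType => i _; exact: mZ.
Qed.

Lemma measurable_avoids n k : measurable (avoids n k).
Proof.
have -> : avoids n k =
    \bigcap_(i in [set i | (n < i <= n + k)%N]) (Z i @^-1` [set~ x0]) by [].
by apply: bigcap_measurableType => i _; exact: mZ.
Qed.

Lemma cylinderS n c :
  cylinder n.+1 c = [set w | Z n.+1 w = c n.+1] `&` cylinder n c.
Proof.
apply/seteqP; split => [w h|w [h1 h2] i].
  by split; [exact: h|move=> i /leqW; exact: h].
by rewrite leq_eqVlt => /predU1P[->//|]; exact: h2.
Qed.

End path_events.

(** * Path probabilities of the chain in terms of the matrix *)

Section chain.
Context {R : realType} {X : countType} (p : X -> X -> R) (hp : stochastic p).
Context {d : measure_display} {Omega : measurableType d}.
Context (P : probability Omega R) (Z : nat -> Omega -> X).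
Hypothesis hZ : markov_chain P Z p.
Variable x0 : X.
Local Open Scope ereal_scope.

Notation cylinder := (cylinder Z).
Notation avoids := (avoids Z x0).

Let mZ n (B : set X) : measurable (Z n @^-1` B).
Proof. by case: hZ => + _ _; exact. Qed.

Let measurable_cylinder n c : measurable (cylinder n c).
Proof. exact: measurable_cylinder. Qed.

Let measurable_avoids n k : measurable (avoids n k).
Proof. exact: measurable_avoids. Qed.

(** The Markov property and the transition law give this for a history of positive probability. For
    a null history they say nothing, but both sides vanish by monotonicity. *)
Lemma prob_cylinderS n c :
  P (cylinder n.+1 c) = P (cylinder n c) * (p (c n) (c n.+1))%:E.
Proof.
case: (hZ) => _ markov trans.
have mH := measurable_cylinder n c; have mH1 := measurable_cylinder n.+1 c.
have sub : P (cylinder n.+1 c) <= P (cylinder n c).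
  by apply: le_measure; rewrite ?inE// cylinderS => w [].
have [H0|Hpos] := eqVneq (P (cylinder n c)) 0.
  by rewrite H0 mul0e; apply/eqP; rewrite eq_le measure_ge0 andbT -H0.
have {}Hpos : 0 < P (cylinder n c) by rewrite lt0e Hpos measure_ge0.
have cpos : 0 < P [set w | Z n w = c n].
  apply: lt_le_trans Hpos _; apply: le_measure; rewrite ?inE//.
    exact: (mZ n [set c n]).
  by move=> w; exact.
rewrite -(trans _ _ _ cpos) -(markov _ _ _ Hpos) /cond_prob.
rewrite -[X in _ `&` X]/(cylinder n c) -cylinderS.
rewrite -[LHS]fineK ?fin_num_measure// -[X in _ = X * _]fineK ?fin_num_measure//.
rewrite -EFinM mulrC divfK// gt_eqF// fine_gt0// Hpos.
by rewrite ltey_eq fin_num_measure.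
Qed.

(** Induction on [k], splitting by the value [y] of [Z n.+1]. For [y = x0] the event is empty,
    matching the zero in [kill]; otherwise the history grows by one step. *)
Lemma prob_cylinder_avoids k n c :
  P (cylinder n c `&` avoids n k) = P (cylinder n c) * avoid_prob p x0 k (c n).
Proof.
elim: k n c => [|k IH] n c.
  rewrite mule1; congr (P _); apply/seteqP; split => [w []//|w h]; split => // i.
  by rewrite addn0 => /andP[/leq_trans h1 /h1]; rewrite ltnn.
have p0 x y : 0 <= (p x y)%:E by rewrite lee_fin; case: hp.
have mE := measurableI _ _ (measurable_cylinder n c) (measurable_avoids n k.+1).
rewrite (measure_esum_fibers P (Z n.+1) _ mE (mZ n.+1)).
have Hfin : P (cylinder n c) \is a fin_num.
  exact: fin_num_measure (measurable_cylinder n c).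
rewrite -[P (cylinder n c)]fineK//.
rewrite [avoid_prob _ _ _ _]/(taboo_step _ _ _ _) -esumZl; last 2 first.
- by move=> y; rewrite mule_ge0// kill_ge0// => ?; exact: avoid_prob_ge0.
- exact/fine_ge0/measure_ge0.
apply: eq_esum => y _; rewrite /kill; case: eqP => [->|/eqP yx0].
  rewrite !mule0 -(measure0 P); congr (P _).
  apply/seteqP; split => // w [[_ /(_ n.+1)]].
  by rewrite addnS !ltnS leqnn leq_addr => /(_ isT).
(* The history extended by [y]; its values beyond [n.+1] are irrelevant. *)
pose c' i := if (i <= n)%N then c i else y.
have c'n : c' n = c n by rewrite /c' leqnn.
have c'S : c' n.+1 = y by rewrite /c' ltnn.
have cyl : cylinder n c' = cylinder n c.
  by apply/seteqP; split => w h i ni; have := h i ni; rewrite /c' ni.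
rewrite fineK//.
have := prob_cylinderS n c'; rewrite cyl c'n c'S muleA => <-.
have := IH n.+1 c'; rewrite c'S => <-; congr (P _).
rewrite cylinderS cyl c'S; apply/seteqP; split => w.
  move=> [[h1 h2] h3]; do !split => //.
  by move=> i /andP[ni ik]; apply: h2; rewrite (ltnW ni) addnS.
move=> [[/= h1 h2] h3]; do !split => //.
move=> i /andP[]; rewrite leq_eqVlt => /predU1P[<- _|ni ik].
  by rewrite h1; apply/eqP.
by apply: h3; rewrite ni addSn -addnS.
Qed.

(** The cylinder at time 0 has probability 1, so intersecting with it loses only a null set. *)
Lemma prob_avoids k : P [set w | Z 0%N w = x0] = 1 ->
  P (avoids 0 k) = avoid_prob p x0 k x0.
Proof.
move=> start.
have E : cylinder 0 (cst x0) = [set w | Z 0%N w = x0].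
  by apply/seteqP; split => [w h|w h i]; [exact: h|rewrite leqn0 => /eqP ->].
have mE : measurable (cylinder 0 (cst x0)) by exact: measurable_cylinder.
have mA := measurable_avoids 0 k.
rewrite -[RHS]mul1e -start -E -prob_cylinder_avoids.
rewrite [LHS](_ : _ = P (avoids 0 k `&` cylinder 0 (cst x0)) +
  P (avoids 0 k `&` ~` cylinder 0 (cst x0))); last first.
  rewrite -measureU; first by rewrite -setIUr setUv setIT.
  - exact: measurableI.
  - by apply: measurableI => //; exact: measurableC.
  - by rewrite setIACA setICr setI0.
rewrite setIC [X in _ + X](_ : _ = 0) ?adde0//; apply/eqP.
rewrite eq_le measure_ge0 andbT.
rewrite (@le_trans _ _ (P (~` cylinder 0 (cst x0))))//.
  apply: le_measure; rewrite ?inE//; last exact: measurableC.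
  by apply: measurableI => //; exact: measurableC.
by rewrite probability_setC// E start subee.
Qed.

End chain.

(* With S_N the partial sum, S_N <= S_(N + M) <= M + (1 - c) S_N. *)
Lemma sum_le_geometric {R : realFieldType} (a : nat -> R) (c : R) M :
  (forall n, 0 <= a n <= 1) -> 0 < c ->
  (forall n, a (n + M)%N <= (1 - c) * a n) ->
  forall N, \sum_(0 <= n < N) a n <= M%:R / c.
Proof.
move=> a01 c0 aM N; have a0 n : 0 <= a n by case/andP: (a01 n).
have le1 : \sum_(0 <= n < N) a n <= \sum_(0 <= n < N + M) a n.
  by rewrite (big_cat_nat (leq0n N) (leq_addr M N))/= lerDl sumr_ge0.
have le2 : \sum_(0 <= n < N + M) a n <= M%:R + (1 - c) * \sum_(0 <= n < N) a n.
  rewrite (big_cat_nat (leq0n M) (leq_addl N M))/= lerD//.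
    rewrite -[X in _ <= X%:R]subn0 -sumr_const_nat ler_sum// => i _.
    by case/andP: (a01 i).
  by rewrite -{1}[M]add0n big_addn addnK mulr_sumr ler_sum.
by rewrite ler_pdivlMr//; lra.
Qed.

(** * First return probabilities and the mean return time *)

Section return_times.
Context {R : realType} {X : countType} {d : measure_display}.
Context {Omega : measurableType d} (P : X -> probability Omega R).
Context (Z : nat -> Omega -> X) (x : X).
Hypothesis mZ : forall n (B : set X), measurable (Z n @^-1` B).

(** The tail of the first return time, real-valued so that differences are harmless. *)
Let q n : R := fine (P x (avoids Z x 0 n)).

(** The first return happens at [n.+1] exactly when [x] is avoided up to [n] but not up to [n.+1];
    these avoidance events are nested. *)
Lemma first_returnS n : first_return P Z n.+1 x x = (q n - q n.+1)%:E.
Proof.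
have mA k : measurable (avoids Z x 0 k) by exact: measurable_avoids.
rewrite EFinB !fineK ?fin_num_measure//.
rewrite -[X in (_ - P x X)%E](_ : avoids Z x 0 n `&` avoids Z x 0 n.+1 = _).
  rewrite -measureD//; last by rewrite ltey_eq fin_num_measure.
  congr (P x _); apply/seteqP; split => w.
    move=> [/= h1 h2]; split; first by move=> i; rewrite add0n; exact: h2.
    by move=> /(_ n.+1); rewrite add0n leqnn => /(_ isT).
  move=> [h1 h2] /=; split; last exact: h1.
  apply: contrapT => h3; apply: h2 => i /andP[i0].
  rewrite add0n leq_eqVlt => /predU1P[->//|]; rewrite ltnS => ik.
  by apply: h1; rewrite i0.
apply/seteqP; split => [w []//|w h]; split => // i /andP[i0 ik].
by apply: h; rewrite i0 add0n (leq_trans ik).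
Qed.

Let q0 : q 0 = 1.
Proof.
rewrite /q (_ : avoids Z x 0 0 = setT) ?probability_setT//.
by apply/seteqP; split => // w _ i; case: i.
Qed.

Let q_ge0 n : 0 <= q n. Proof. exact/fine_ge0/measure_ge0. Qed.

Let first_return_ge0 n : (0 <= first_return P Z n x x)%E.
Proof. by case: n => [//|n]; exact: measure_ge0. Qed.

Let qS n : q n.+1 <= q n.
Proof.
by have := first_return_ge0 n.+1; rewrite first_returnS lee_fin subr_ge0.
Qed.

Variables (C : R) (hC : forall N, \sum_(0 <= n < N) q n <= C).

(** The partial sums telescope to [1 - q N], and [q] tends to 0: being nonincreasing with sums at
    most [C], it satisfies [N * q N <= C]. *)
Lemma return_prob_ge1 : (1 <= return_prob P Z x x)%E.
Proof.
have partial N : ((1 - q N)%:E <= return_prob P Z x x)%E.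
  rewrite (_ : (1 - q N)%:E = \sum_(0 <= n < N.+1) first_return P Z n x x)%E.
    exact: nneseries_lim_ge.
  rewrite big_nat_recl// [first_return _ _ 0 _ _]/= add0e.
  under eq_bigr do rewrite first_returnS.
  rewrite sumEFin; congr EFin.
  elim: N => [|N IH]; first by rewrite big_geq// q0 subrr.
  by rewrite big_nat_recr//= -IH; ring.
have Nq N : N%:R * q N <= C.
  apply: le_trans (hC N).
  rewrite mulr_natl -[X in _ *+ X]subn0 -sumr_const_nat; apply: ler_sum_nat.
  move=> i /andP[_ /ltnW]; have := @nonincreasing_seqP _ R q.
  by move=> [+ _] => /(_ qS)/[apply].
rewrite leNgt; apply/negP; move: partial.
case: (return_prob P Z x x) => [r| |] // partial; last first.
  by have := partial 0%N; rewrite leeNy_eq.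
rewrite lte_fin => r1; have r10 : 0 < 1 - r by rewrite subr_gt0.
have C0 : 0 <= C by apply: le_trans (hC 0); rewrite big_geq.
(* A value [r < 1] would force [q N >= 1 - r] for all [N], hence [N * (1 - r) <= C], which fails
   once [N] exceeds [C / (1 - r)]. *)
have := archi_boundP (divr_ge0 C0 (ltW r10)).
set N := Num.bound _; rewrite ltr_pdivrMr// ltNge => /negP; apply.
apply: le_trans (Nq N); apply: ler_wpM2l => //.
by have := partial N; rewrite lee_fin; lra.
Qed.

(** Summation by parts turns the partial sums into sums of [q] minus the nonnegative boundary term
    [N * q N], so [C] bounds them all. *)
Lemma mean_return_time_lt_pinfty : (mean_return_time P Z x < +oo)%E.
Proof.
apply: (@le_lt_trans _ _ C%:E); last exact: ltry.
have term_ge0 n : (0 <= n%:R%:E * first_return P Z n x x)%E.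
  by rewrite mule_ge0// lee_fin.
apply: lime_le; first exact: is_cvg_nneseries.
apply: nearW => -[|N].
  by rewrite big_geq// lee_fin (le_trans _ (hC 0))// big_geq.
rewrite big_add1 -[N.+1.-1]/N; under eq_bigr do rewrite first_returnS -EFinM.
rewrite sumEFin lee_fin; apply: le_trans (hC N).
suff -> : \sum_(0 <= n < N) n.+1%:R * (q n - q n.+1) =
    \sum_(0 <= n < N) q n - N%:R * q N.
  by rewrite gerBl mulr_ge0.
elim: N => [|N IH]; first by rewrite !big_geq// mul0r subrr.
by rewrite !big_nat_recr//= IH -natr1; ring.
Qed.

End return_times.

Theorem theorem2p2 (R : realType) (X : countType) (p : X -> X -> R)
  (d : measure_display) (Omega : measurableType d)
  (P : X -> probability Omega R) (Z : nat -> Omega -> X)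
  (hp : stochastic p) (hZ : markov_family P Z p) (hirr : irreducible p)
  (eps : R) (heps : 0 < eps < 1) (A : set X) (hA : finite_set A)
  (hsup : (ereal_sup [set \esum_(y in ~` A) (p x y)%:E | x in [set: X]]
           < eps%:E)%E) :
  positive_recurrent P Z.
Proof.
have eps1 : eps < 1 by case/andP: heps.
have hA' x : (\esum_(y in ~` A) (p x y)%:E <= eps%:E)%E.
  by apply: le_trans (ltW hsup); apply: ereal_sup_ubound; exists x.
have mZ (x : X) n (B : set X) : measurable (Z n @^-1` B).
  by have [_ [mZ _ _]] := hZ x; exact: mZ.
(* Every state [x] takes the role of [x0] in turn, with its own [c] and [M]. *)
have main x : exists C : R, forall N,
    \sum_(0 <= n < N) fine (P x (avoids Z x 0 n)) <= C.
  have [c [M [/andP[c0 c1] hM]]] :=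
    avoid_prob_uniform p hp x eps A hirr eps1 hA hA'.
  have [start chain] := hZ x.
  have afin n : avoid_prob p x n x \is a fin_num.
    rewrite ge0_fin_numE ?avoid_prob_ge0//.
    by rewrite (le_lt_trans (avoid_prob_le1 p hp x n x))// ltry.
  exists (M%:R / c); apply: sum_le_geometric => // n;
    rewrite !(prob_avoids p hp (P x) Z chain x _ start).
    by rewrite fine_ge0 ?avoid_prob_ge0//= -lee_fin fineK ?avoid_prob_le1.
  rewrite -lee_fin EFinM !fineK//; exact: avoid_prob_geometric.
split=> [[x]|x]; have [C hC] := main x.
  by rewrite ltNge (return_prob_ge1 P Z x (mZ x) C).
exact: (mean_return_time_lt_pinfty P Z x (mZ x) C).
Qed.
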